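(* If $E\subset\mathbb{R}$ is $\operatorname{lip}1$, then $E$ is a strongly one-sided dense $F_\sigma$ set.
   Context: For a continuous $f:\mathbb{R}\to\mathbb{R}$, $x\in\mathbb{R}$ and $r>0$ put $M_f(x,r)=\frac{1}{r}\sup\{|f(x)-f(y)|:|x-y|\le r\}$ and $\operatorname{lip} f(x)=\liminf_{r\to0^+}M_f(x,r)$. A set $E\subseteq\mathbb{R}$ is $\operatorname{lip}1$ if there is a continuous $f:\mathbb{R}\to\mathbb{R}$ with $\operatorname{lip} f=\mathbf{1}_E$ (the characteristic function of $E$). $|A|$ denotes the Lebesgue measure of $A$. A measurable set $E$ is strongly one-sided dense at $x$ if for every sequence $r_n\searrow0$ of positive numbers we have $\max\left\{\frac{|E\cap[x-r_n,x]|}{r_n},\frac{|E\cap[x,x+r_n]|}{r_n}\right\}\to1$; $E$ is strongly one-sided dense if it is strongly one-sided dense at every $x\in E$. *)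

(* Defs.v *)
From HB Require Import structures.
From mathcomp Require Import all_boot all_order all_algebra.
From mathcomp Require Import all_classical all_reals all_analysis.

Set Implicit Arguments.
Unset Strict Implicit.
Unset Printing Implicit Defensive.

Import Order.TTheory GRing.Theory Num.Theory.
Import numFieldNormedType.Exports.

Local Open Scope classical_set_scope.
Local Open Scope ring_scope.

(* M_f(x, r), meaningful for r > 0; the supremum is taken in \bar R, so no
   boundedness side condition is hidden in it. *)
Definition osc_quot (R : realType) (f : R -> R) (x r : R) : \bar R :=
  ((r^-1)%:E *
   ereal_sup [set `|f x - f y|%:E | y in [set y : R | (`|x - y| <= r)%R]])%E.

Definition little_lip (R : realType) (f : R -> R) (x : R) : \bar R :=
  limf_einf (osc_quot f x) 0^'+.

Definition lip1 (R : realType) (E : set R) : Prop :=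
  exists2 f : R -> R, continuous f & forall x, little_lip f x = (\1_E x)%:E.

(* Lebesgue (not only Borel) measurability: the Caratheodory sigma-algebra of
   the Lebesgue outer measure, which is the domain of
   [completed_lebesgue_measure]. *)
Definition lebesgue_measurable (R : realType) (E : set R) : Prop :=
  ((wlength (@idfun R))^*)%mu.-cara.-measurable E.

Definition strongly_one_sided_dense_at (R : realType) (E : set R) (x : R) :
    Prop :=
  forall r : R^nat, (forall n, 0 < r n) -> nonincreasing_seq r ->
    r @ \oo --> (0 : R) ->
    (Order.max
       (completed_lebesgue_measure (E `&` `[(x - r n)%R, x]) * ((r n)^-1)%:E)
       (completed_lebesgue_measure (E `&` `[x, (x + r n)%R]) * ((r n)^-1)%:E))%E
      @[n --> \oo] --> (1%:E : \bar R).

Definition strongly_one_sided_dense (R : realType) (E : set R) : Prop :=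
  lebesgue_measurable E /\ forall x, E x -> strongly_one_sided_dense_at E x.

(* Main.v *)
(* Write [lip f = 1_E].  If x is a limit of points at which f oscillates by more
   than r/2 at every scale r < 1/n, then [lip f x] cannot vanish; closing up these
   sets writes E as a countable union of closed sets.

   For the density, [lip f <= 1_E] forces |f b - f a| <= |E `&` [a, b]|: take
   an open G containing E `&` [a, b] and g t = |G `&` [a, t]| + e t; from every x
   there are arbitrarily small steps r along which f moves at most as much as g,
   and a supremum argument propagates this from a to b.  Since [lip f x = 1] at
   x in E, every small r admits y with |x - y| <= r and |f x - f y| > (1 - e) r,
   so E fills the proportion 1 - e of the half-interval on the side of y. *)
Require Import Defs.
From mathcomp Require Import all_boot all_order all_algebra.
From mathcomp Require Import all_classical all_reals all_analysis.
From mathcomp Require Import borel_hierarchy.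
From mathcomp Require Import measurable_realfun lra.
Import numFieldNormedType.Exports.
Import Order.TTheory GRing.Theory Num.Theory.

Local Open Scope classical_set_scope.
Local Open Scope ring_scope.

Lemma osc_quot_lt {R : realType} (f : R -> R) (x r c : R) : 0 < r ->
  (osc_quot f x r < c%:E)%E ->
  forall y, `|x - y| <= r -> `|f x - f y| <= c * r.
Proof.
move=> r0 + y xy; rewrite /osc_quot.
set S := ereal_sup _ => Sc.
have yS : (`|f x - f y|%:E <= S)%E by apply: ereal_sup_ubound; exists y.
rewrite -lee_fin; apply: (le_trans yS).
by rewrite EFinM -lee_pdivrMr// muleC ltW.
Qed.

Lemma osc_quot_gt {R : realType} (f : R -> R) (x r c : R) : 0 < r ->
  (c%:E < osc_quot f x r)%E ->
  exists2 y, `|x - y| <= r & c * r < `|f x - f y|.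
Proof.
move=> r0; rewrite /osc_quot muleC lte_pdivlMr// -EFinM.
by move=> /ereal_sup_gt[_ [y xy <-]]; rewrite lte_fin; exists y.
Qed.

Lemma little_lip_lt {R : realType} (f : R -> R) (x c d : R) :
  (little_lip f x < c%:E)%E -> 0 < d ->
  exists2 r, 0 < r < d & forall y, `|x - y| <= r -> `|f x - f y| <= c * r.
Proof.
rewrite /little_lip limf_einfE => lip_lt d0.
(* The liminf is a supremum of infima over right neighbourhoods of 0; []0, d[] is one of them. *)
have : (ereal_inf (osc_quot f x @` `]0%R, d[) < c%:E)%E.
  apply: le_lt_trans lip_lt; apply: ereal_sup_ubound.
  exists `]0, d[%classic => //.
  by near=> r; rewrite /= in_itv/=; apply/andP; split.
move=> /ereal_inf_lt[_ [r rd <-] rc].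
move: rd; rewrite /= in_itv/= => rd; exists r => //.
by apply: osc_quot_lt rc; case/andP: rd.
Unshelve. all: by end_near. Qed.

Lemma little_lip_gt {R : realType} (f : R -> R) (x c : R) :
  (c%:E < little_lip f x)%E ->
  \forall r \near 0^'+, exists2 y, `|x - y| <= r & c * r < `|f x - f y|.
Proof.
rewrite /little_lip limf_einfE => /ereal_sup_gt[_ [V V0 <-] cV].
near=> r; apply: osc_quot_gt => //.
apply: (lt_le_trans cV); apply: ereal_inf_lbound; exists r => //.
by near: r.
Unshelve. all: by end_near. Qed.

Lemma little_lip_indic_Fsigma {R : realType} (f : R -> R) (E : set R) :
  (forall x, little_lip f x = (\1_E x)%:E) -> Fsigma E.
Proof.
move=> lipf.
(* Any slope strictly between 0 and 1 would serve as threshold; closing [A n] only costs a fixed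
   factor in it, as the constants below show. *)
pose A n := [set x | forall r, 0 < r < n.+1%:R^-1 ->
  exists2 y, `|x - y| <= r & 2^-1 * r < `|f x - f y|].
exists (fun n => closure (A n)); first by move=> n; exact: closed_closure.
apply/seteqP; split=> [x Ex|x [n _ clAx]].
  have : ((2^-1 : R)%:E < little_lip f x)%E.
    by rewrite lipf indicE mem_set// lte_fin /=; lra.
  move=> /little_lip_gt[d /= d0 hd].
  have [n nd] : exists n, n.+1%:R^-1 < d.
    near \oo => n; exists n; near: n; exact: (near_infty_natSinv_lt (PosNum d0)).
  exists n => //; apply: subset_closure => r /andP[r0 rn].
  by apply: hd => //=; rewrite sub0r normrN gtr0_norm// (lt_trans rn).
apply: contrapT => nEx.
(* Some [x'] in [A n] lies within r/2 of x, and scale r/2 at [x'] gives y with |f x' - f y| > r/4.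
   Both [x'] and y are within r of x, where f moves by at most r/8: a contradiction. *)
have : (little_lip f x < (8^-1 : R)%:E)%E.
  by rewrite lipf indicE memNset// lte_fin /=; lra.
have n0 : 0 < n.+1%:R^-1 :> R by rewrite invr_gt0.
move=> /little_lip_lt/(_ n0)[r /andP[r0 rn] fx].
have r20 : 0 < r / 2 by lra.
have [x' [Ax' xx']] := clAx _ (nbhsx_ballx x (r / 2) r20).
have /Ax'[y x'y] : 0 < r / 2 < n.+1%:R^-1.
  by rewrite r20 (lt_trans _ rn)//; lra.
have xx'r : `|x - x'| < r / 2 := xx'.
have xyr : `|x - y| <= r.
  by have := ler_distD x' x y; lra.
have := fx _ xyr; have : `|f x - f x'| <= 8^-1 * r by apply: fx; lra.
by have := ler_distD (f x) (f x') (f y); rewrite (distrC (f x') (f x)); lra.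
Unshelve. all: by end_near. Qed.

(** Let s be the supremum of the t for which the bound holds on [[a, t]]. The bound passes to s, and
    if s < b the step available at s would carry it beyond s. *)
Lemma increment_le_of_local {R : realType} (f g : R -> R) (a b : R) :
  a <= b -> continuous f -> {homo g : x y / x <= y} ->
  (forall x, a <= x < b -> exists2 r, 0 < r <= b - x &
    `|f (x + r) - f x| <= g (x + r) - g x) ->
  `|f b - f a| <= g b - g a.
Proof.
move=> ab cf gnd step.
pose S := [set t | a <= t <= b /\ `|f t - f a| <= g t - g a].
have Sa : S a by split; rewrite ?lexx ?ab// !subrr normr0.
have ubS : ubound S b by move=> t [/andP[]].
have hS : has_sup S by split; [exists a|exists b].
set s := sup S.
have as_ : a <= s by apply: ub_le_sup => //; exists b.
have sb : s <= b by apply: ge_sup => //; exists a.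
have Ss : `|f s - f a| <= g s - g a.
  (* Passing from t to s uses continuity for f and monotonicity for g. *)
  apply/ler_addgt0Pr => e e0.
  have /cvgrPdist_lt/(_ _ e0)[d /= d0 fd] := cf s.
  have [t St st] := sup_adherent d0 hS.
  have ts : t <= s by apply: ub_le_sup => //; exists b.
  have /fd/ltW fst : `|s - t| < d by rewrite ger0_norm; rewrite -/s in st; lra.
  have [_ fta] := St; have := gnd _ _ ts.
  by have := ler_distD (f t) (f s) (f a); lra.
have [->//|sb'] := eqVneq b s.
have /step[r /andP[r0 rb] fr] : a <= s < b by rewrite as_ lt_neqAle eq_sym sb' sb.
suff : s + r <= s by lra.
apply: ub_le_sup; first by exists b.
split; first by apply/andP; split; lra.
by have := ler_distD (f s) (f (s + r)) (f a); lra.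
Qed.

Lemma lebesgue_measure_setI_itv_le {R : realType} (A : set R) (a b : R) :
  measurable A -> a <= b ->
  (lebesgue_measure (A `&` `[a, b]) <= (b - a)%:E)%E.
Proof.
move=> mA ab; apply: (@le_trans _ _ (lebesgue_measure `[a, b]%classic)).
  by apply: le_measure; rewrite ?inE//; exact: measurableI.
rewrite lebesgue_measure_itv/= lte_fin; case: ifPn => // _.
by rewrite lee_fin subr_ge0.
Qed.

Lemma lebesgue_measure_setI_itv_fin {R : realType} (A : set R) (a b : R) :
  measurable A -> lebesgue_measure (A `&` `[a, b]) \is a fin_num.
Proof.
move=> mA; have [ab|ba] := leP a b.
  rewrite ge0_fin_numE//; apply: le_lt_trans (ltry (b - a)).
  exact: lebesgue_measure_setI_itv_le.
by rewrite set_itv_ge ?setI0 ?measure0// -ltNge.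
Qed.

Lemma lebesgue_measure_setI_itv_addr {R : realType} (A : set R) (a x r : R) :
  measurable A -> a <= x -> 0 <= r -> `[x, x + r] `<=` A ->
  (lebesgue_measure (A `&` `[a, x]) + r%:E
    <= lebesgue_measure (A `&` `[a, (x + r)%R]))%E.
Proof.
move=> mA ax r0 xrA.
(* The half-open interval has length r and is disjoint from [[a, x]]. *)
have -> : r%:E = lebesgue_measure `]x, (x + r)%R]%classic.
  rewrite lebesgue_measure_itv/= lte_fin; case: ifPn => [_|].
    by rewrite -EFinD; congr EFin; lra.
  by rewrite -leNgt => rx; congr EFin; lra.
have mAx : measurable (A `&` `[a, x]) by exact: measurableI.
rewrite -measureU//; last first.
  apply/seteqP; split => // y [[_]] /=; rewrite !in_itv/= => /andP[_ ?] /andP[? _]; lra.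
apply: le_measure; rewrite ?inE; [exact: measurableU|exact: measurableI|].
move=> y [[Ay]|]; rewrite /= !in_itv/= => /andP[? ?].
  by split => //; apply/andP; split; lra.
by split; [apply: xrA; rewrite /= in_itv/=|]; apply/andP; split; lra.
Qed.

Lemma little_lip_indic_increment_le {R : realType} (f : R -> R) (E : set R)
    (a b : R) :
  measurable E -> continuous f -> a <= b ->
  (forall x, (little_lip f x <= (\1_E x)%:E)%E) ->
  (`|f b - f a|%:E <= lebesgue_measure (E `&` `[a, b]))%E.
Proof.
move=> mE cf ab lipf.
rewrite -[leRHS]fineK ?lebesgue_measure_setI_itv_fin// lee_fin.
suff bound e : 0 < e ->
    `|f b - f a| <= fine (lebesgue_measure (E `&` `[a, b])) + e + e * (b - a).
  apply/ler_addgt0Pr => e e0.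
  (* With this choice the two error terms add up to exactly e; the summand 1 keeps the denominator
     positive when a = b. *)
  have d0 : 0 < e / (1 + (b - a)) by apply: divr_gt0 => //; lra.
  apply: (le_trans (bound _ d0)).
  set d := e / _; have -> : e = d * (1 + (b - a)).
    by rewrite /d divfK//; apply/eqP; lra.
  by lra.
move=> e0.
have mEab : measurable (E `&` `[a, b]) by exact: measurableI.
have [|G [oG EG GE]] := lebesgue_regularity_outer mEab _ e0.
  by rewrite ltey_eq lebesgue_measure_setI_itv_fin.
have mG : measurable G by exact: open_measurable.
(* The linear term pays for the slope e allowed at points outside E; at points of E the measure of G
   supplies the additional slope 1. *)
pose g t := fine (lebesgue_measure (G `&` `[a, t])) + e * (t - a).
have gab : g b - g a <=
    fine (lebesgue_measure (E `&` `[a, b])) + e + e * (b - a).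
  have : 0 <= fine (lebesgue_measure (G `&` `[a, a])) by exact: fine_ge0.
  suff : fine (lebesgue_measure (G `&` `[a, b])) <=
      fine (lebesgue_measure (E `&` `[a, b])) + e by rewrite /g; lra.
  rewrite -lee_fin EFinD !fineK ?lebesgue_measure_setI_itv_fin//.
  apply: (le_trans _ (leeD2l _ (ltW GE))).
  rewrite -measureU//; [|exact: measurableD|by rewrite setDIK].
  apply: le_measure; rewrite ?inE; [exact: measurableI| |].
    by apply: measurableU => //; exact: measurableD.
  by move=> x [Gx xab]; have [|] := pselect ((E `&` `[a, b]) x); [left|right].
have g_ge x y : x <= y -> e * (y - x) <= g y - g x.
  move=> xy; suff : fine (lebesgue_measure (G `&` `[a, x])) <=
      fine (lebesgue_measure (G `&` `[a, y])) by rewrite /g; lra.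
  apply: fine_le; rewrite ?lebesgue_measure_setI_itv_fin//.
  apply: le_measure; rewrite ?inE; [exact: measurableI..|].
  by apply: setIS; apply: subset_itvl; rewrite bnd_simp.
apply: (le_trans _ gab); apply: increment_le_of_local => //.
  move=> x y xy; rewrite -subr_ge0; apply: le_trans (g_ge _ _ xy).
  by rewrite mulr_ge0 ?subr_ge0// ltW.
move=> x /andP[ax xb].
have bx0 : 0 < b - x by lra.
have lipfx : (little_lip f x < (\1_E x + e)%:E)%E.
  by apply: le_lt_trans (lipf x) _; rewrite lte_fin ltrDl.
have [Ex|nEx] := pselect (E x); last first.
  have [r /andP[r0 rb] fr] := little_lip_lt _ _ _ _ lipfx bx0.
  exists r; first by rewrite r0 ltW.
  have := fr (x + r); rewrite distrC (distrC (f x)) addrAC subrr add0r.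
  rewrite gtr0_norm// => /(_ (lexx _)).
  rewrite indicE memNset// add0r => /le_trans; apply.
  have -> : r = x + r - x by lra.
  by rewrite {2}addrAC subrr add0r; apply: g_ge; lra.
have : G x by apply: EG; split => //=; rewrite in_itv/= ax ltW.
rewrite openE in oG.
move=> /oG[d /= d0 dG].
(* A step below d keeps [[x, x + r]] inside G, so the measure term of g grows by at least r; a step
   below b - x does not overshoot b. *)
have m0 : 0 < Num.min d (b - x) by rewrite lt_min d0.
have [r /andP[r0]] := little_lip_lt _ _ _ _ lipfx m0.
rewrite lt_min => /andP[rd rb] fr.
exists r; first by apply/andP; split=> //; lra.
have := fr (x + r); rewrite distrC (distrC (f x)) addrAC subrr add0r.
rewrite gtr0_norm// => /(_ (lexx _)).
rewrite indicE mem_set// => /le_trans; apply.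
suff : fine (lebesgue_measure (G `&` `[a, x])) + r <=
  fine (lebesgue_measure (G `&` `[a, (x + r)%R])) by rewrite /g/=; lra.
rewrite -lee_fin EFinD !fineK ?lebesgue_measure_setI_itv_fin//.
apply: lebesgue_measure_setI_itv_addr => //; first exact: ltW.
move=> y; rewrite /= in_itv/= => /andP[? ?]; apply: dG => /=.
by rewrite ler0_norm; lra.
Qed.

Theorem theorem4p6 (R : realType) (E : set R) :
  lip1 E -> strongly_one_sided_dense E /\ Fsigma E.
Proof.
case=> f cf lipf.
have FE : Fsigma E := little_lip_indic_Fsigma f E lipf.
have mE : measurable E.
  have [F cF ->] := FE; apply: bigcupT_measurable => n.
  exact: closed_measurable.
split=> //; split; first exact: sub_caratheodory.
move=> x Ex r r_gt0 _ r0.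
have r0' : r @ \oo --> 0^'+.
  move=> V /r0 rV.
  by apply: (filterS _ (rV : \forall n \near \oo, 0 < r n -> V (r n))) => n; apply.
(* Both measures are the same outer measure on different sigma-algebras, hence convertible. *)
change (@completed_lebesgue_measure R) with (@lebesgue_measure R).
pose u n := Num.max (fine (lebesgue_measure (E `&` `[x - r n, x])) / r n)
                    (fine (lebesgue_measure (E `&` `[x, x + r n])) / r n).
rewrite [X in X @ _](_ : _ = EFin \o u); last first.
  apply/funext => n /=; rewrite EFin_max !EFinM !fineK//.
    exact: lebesgue_measure_setI_itv_fin.
  exact: lebesgue_measure_setI_itv_fin.
apply: cvg_EFin; first by near=> n.
apply/cvgrPdist_le => e e0.
have : ((1 - e)%:E < little_lip f x)%E.
  by rewrite lipf indicE mem_set// lte_fin /=; lra.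
move=> /little_lip_gt fr.
have {}fr : \forall n \near \oo,
    exists2 y, `|x - y| <= r n & (1 - e) * r n < `|f x - f y| := r0' _ fr.
apply: filterS fr => n [y xy fxy].
have rn0 := r_gt0 n.
(* Each half-interval has length [r n], so only the lower bound 1 - e remains to be shown. *)
have u1 : u n <= 1.
  rewrite /u ge_max !ler_pdivrMr// !mul1r -!lee_fin.
  rewrite !fineK ?lebesgue_measure_setI_itv_fin//; apply/andP; split.
    apply: le_trans (lebesgue_measure_setI_itv_le _ _ _ mE _) _; first by lra.
    by rewrite lee_fin; lra.
  apply: le_trans (lebesgue_measure_setI_itv_le _ _ _ mE _) _; first by lra.
  by rewrite lee_fin; lra.
have lipE z : (little_lip f z <= (\1_E z)%:E)%E by rewrite lipf.
suff : 1 - e <= u n.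
  by rewrite ger0_norm ?subr_ge0// lerBlDr -lerBlDl.
rewrite /u le_max !ler_pdivlMr// -!lee_fin.
rewrite !fineK ?lebesgue_measure_setI_itv_fin//; apply/orP.
(* The side on which y lies selects the half-interval: it contains the segment between x and y, on
   which E has measure at least |f x - f y| > (1 - e) [r n]. *)
have [yx|/ltW yx] := leP y x; [left|right].
  apply: le_trans (le_trans (little_lip_indic_increment_le f E _ _ mE cf yx lipE) _).
    by rewrite lee_fin ltW.
  apply: le_measure; rewrite ?inE; [exact: measurableI..|].
  apply: setIS; apply: subset_itvr; rewrite bnd_simp.
  by have := ler_norm (x - y); lra.
apply: le_trans (le_trans (little_lip_indic_increment_le f E _ _ mE cf yx lipE) _).
  by rewrite lee_fin distrC ltW.
apply: le_measure; rewrite ?inE; [exact: measurableI..|].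
apply: setIS; apply: subset_itvl; rewrite bnd_simp.
by rewrite distrC in xy; have := ler_norm (y - x); lra.
Unshelve. all: by end_near. Qed.
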